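(* Let $X$ be a centered infinitely divisible random vector in $\mathbb{R}^d$ with finite second moment. The function $C_X:\mathbb{R}^d\to[0,\infty]$ is an admissible radial denominator for $X$. If $q:\mathbb{R}^d\to[0,\infty]$ is any admissible radial denominator for $X$, then $$q(t)\ge C_X(t)\qquad\text{for every }t\in\mathbb{R}^d.$$
   Context: $X$ is a centered infinitely divisible random vector in $\mathbb{R}^d$ with finite second moment and covariance matrix $\Sigma$; $K_X(t):=\log\mathbb{E}e^{\langle t,X\rangle}$ (value $+\infty$ allowed) and $V_X(t):=t^\top\Sigma t$. Directional (radial) pole: if $V_X(t)>0$, $C_X(t)\in[0,\infty]$ is the infimum of all $c\in[0,\infty)$ such that $$K_X(st)\le\frac{V_X(t)s^2}{2(1-cs)}\qquad\text{for all }0\le s<1/c,$$ with $1/0=\infty$ and $\inf\emptyset=\infty$. If $V_X(t)=0$, $C_X(t):=0$. Admissible radial denominator: a function $q:\mathbb{R}^d\to[0,\infty]$ is admissible for $X$ if it is positively homogeneous, i.e. $q(at)=a\,q(t)$ for all $a\ge0$ and $t\in\mathbb{R}^d$ (with $0\cdot\infty=0$), and $$K_X(t)\le\frac{V_X(t)}{2(1-q(t))}\qquad\text{whenever }q(t)<1.$$ *)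

(* Defs.v *)
From HB Require Import structures.
From mathcomp Require Import all_boot all_order all_algebra.
From mathcomp Require Import all_classical all_reals all_analysis.

Set Implicit Arguments.
Unset Strict Implicit.
Unset Printing Implicit Defensive.

Import Order.TTheory GRing.Theory Num.Theory.
Import numFieldNormedType.Exports.

Local Open Scope classical_set_scope.
Local Open Scope ring_scope.

(* A random vector in R^d is a measurable map into [d.-tuple R], whose
   sigma-algebra is generated by the coordinates, i.e. the Borel one.
   Deterministic directions t are column vectors. *)

Section infinite_divisibility.
Context {R : realType}.

Definition independent_vectors {disp : measure_display}
    {T : measurableType disp} (P : probability T R) (d n : nat)
    (Y : 'I_n -> {RV P >-> d.-tuple R}) : Prop :=
  forall (J : {set 'I_n}) (A : 'I_n -> set (d.-tuple R)),
    (forall k, measurable (A k)) ->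
    P (\bigcap_(k in [set` J]) (Y k @^-1` A k)) =
      (\prod_(k in J) P (Y k @^-1` A k))%E.

Definition identically_distributed {disp : measure_display}
    {T : measurableType disp} (P : probability T R) (d n : nat)
    (Y : 'I_n -> {RV P >-> d.-tuple R}) : Prop :=
  forall (j k : 'I_n) (A : set (d.-tuple R)), measurable A ->
    distribution P (Y j) A = distribution P (Y k) A.

Definition sum_vectors {T : Type} (d n : nat)
    (Y : 'I_n -> T -> d.-tuple R) (w : T) : d.-tuple R :=
  [tuple \sum_(k < n) tnth (Y k w) i | i < d].

(* The i.i.d. summands may live on another probability space. *)
Definition infinitely_divisible {disp : measure_display}
    {T : measurableType disp} (P : probability T R) (d : nat)
    (X : {RV P >-> d.-tuple R}) : Prop :=
  forall n : nat, (0 < n)%N ->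
  exists (disp' : measure_display) (T' : measurableType disp')
         (P' : probability T' R) (Y : 'I_n -> {RV P' >-> d.-tuple R}),
    [/\ independent_vectors Y,
        identically_distributed Y &
        forall A : set (d.-tuple R), measurable A ->
          pushforward P' (sum_vectors (fun k => Y k : T' -> d.-tuple R)) A =
          distribution P X A].

End infinite_divisibility.

Section random_vector.
Context {R : realType} {disp : measure_display} {T : measurableType disp}.
Context (P : probability T R) {d : nat}.
Implicit Types (X : {RV P >-> d.-tuple R}) (t : 'cV[R]_d).

Definition component X (i : 'I_d) : T -> R := fun w => tnth (X w) i.

Definition dot X t : T -> R := fun w => \sum_(i < d) t i 0 * component X i w.

Definition centered X : Prop := forall i : 'I_d, ('E_P[component X i] = 0)%E.

Definition finite_second_moment X : Prop :=
  ('E_P[fun w => (\sum_(i < d) component X i w ^+ 2)%R] < +oo)%E.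

Definition covariance_matrix X : 'M[R]_d :=
  \matrix_(i, j) fine (covariance P (component X i) (component X j)).

Definition cumulant X t : \bar R := lne 'E_P[fun w => expR (dot X t w)].

Definition quad_form X t : R := (t^T *m covariance_matrix X *m t) 0 0.

(* [inve] sends 0 to +oo and [ereal_inf set0] is +oo, which are the
   conventions 1/0 = oo and inf of the empty set = oo. *)
Definition radial_pole X t : \bar R :=
  if 0 < quad_form X t then
    ereal_inf [set c%:E | c in [set c : R | 0 <= c /\
      forall s : R, 0 <= s -> (s%:E < (c%:E)^-1)%E ->
        (cumulant X (s *: t) <=
           (quad_form X t * s ^+ 2 / (2 * (1 - c * s)))%:E)%E]]
  else 0%E.

(* In [\bar R], 0 * +oo = 0. *)
Definition admissible_radial_denominator X (q : 'cV[R]_d -> \bar R) : Prop :=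
  [/\ forall t, (0 <= q t)%E,
      forall (a : R) t, 0 <= a -> q (a *: t) = (a%:E * q t)%E &
      forall t, (q t < 1)%E ->
        (cumulant X t <= (quad_form X t)%:E / (2%:E * (1 - q t)))%E].

End random_vector.

(* Main.v *)
Require Import Defs.
From mathcomp Require Import all_boot all_order all_algebra.
From mathcomp Require Import all_classical all_reals all_analysis.
From mathcomp Require Import measurable_realfun ring lra.

(* If V(t) > 0 and q(t) = c is finite, homogeneity turns the admissibility of q
   along the ray through t into the inequality that defines the radial pole, so
   c dominates the infimum.  Conversely the defining inequality at s = 1 is
   closed in c, hence holds at the infimum.  If V(t) = 0, then <t, X> vanishes
   almost surely, so K(t) = 0. *)

Import Order.TTheory GRing.Theory Num.Theory.

Section radial_pole_theory.
Context {R : realType} {disp : measure_display} {T : measurableType disp}.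
Context {P : probability T R} {d : nat} (X : {RV P >-> d.-tuple R}).
Implicit Types (t : 'cV[R]_d) (i j : 'I_d) (a c s : R).
Local Open Scope classical_set_scope.
Local Open Scope ring_scope.

Lemma measurable_component i : measurable_fun setT (component X i).
Proof. exact: (measurableT_comp (measurable_tnth i)). Qed.

Lemma measurable_dot t : measurable_fun setT (dot X t).
Proof.
apply: measurable_sum => i; apply: measurable_funM => //.
exact: measurable_component.
Qed.

(** Domination by the squared norm [S]: both squares are at most [S w], and [0 <= (x - y) ^+ 2]
    gives [x * y <= (x ^+ 2 + y ^+ 2) / 2 <= S w]. *)
Lemma integrable_component_mul : finite_second_moment X -> forall i j,
  P.-integrable setT (EFin \o (component X i \* component X j)).
Proof.
rewrite /finite_second_moment unlock => X2 i j.
set S : T -> R := fun w => \sum_(k < d) component X k w ^+ 2 in X2 *.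
have S0 w : 0 <= S w by apply: sumr_ge0 => k _; exact: sqr_ge0.
have mS : measurable_fun setT S.
  apply: measurable_sum => k; apply: measurable_funX.
  exact: measurable_component.
have le_S k w : component X k w ^+ 2 <= S w.
  by rewrite /S (bigD1 k)//= lerDl sumr_ge0// => l _; exact: sqr_ge0.
apply: (@le_integrable _ _ _ P _ measurableT _ (EFin \o S)) => //=.
- apply/measurable_EFinP; apply: measurable_funM; exact: measurable_component.
- move=> w _; rewrite lee_fin (ger0_norm (S0 w)) normrM.
  have := le_S i w; have := le_S j w.
  rewrite -(real_normK (num_real (component X i w))).
  rewrite -(real_normK (num_real (component X j w))).
  set x := `|component X i w|; set y := `|component X j w| => ? ?.
  have := sqr_ge0 (x - y); nra.
- apply/integrableP; split; first exact/measurable_EFinP.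
  by under eq_integral => w _ do rewrite /= ger0_norm//.
Qed.

Lemma covariance_centered : centered X -> forall i j,
  covariance P (component X i) (component X j) =
  ('E_P[component X i \* component X j])%E.
Proof.
move=> X0 i j; rewrite unlock !X0 /=; congr expectation.
by apply/funext => w /=; rewrite !fctE/= !subr0.
Qed.

(** Expanding the square and integrating term by term identifies the second moment of [dot X t] with
    the quadratic form of the covariance matrix. *)
Lemma expectation_dot_sqr t : centered X -> finite_second_moment X ->
  ('E_P[fun w => (dot X t w ^+ 2)%R] = (quad_form X t)%:E)%E.
Proof.
move=> X0 X2.
have iX i j := integrable_component_mul X2 i j.
(* The outer sum runs over [j] to match the bracketing [(t^T *m covariance_matrix X) *m t]. *)
have -> : (fun w => dot X t w ^+ 2) = (fun w => \sum_(j < d) \sum_(i < d)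
    (t i 0 * t j 0) * (component X i \* component X j) w).
  apply/funext => w; rewrite expr2 /dot mulr_sumr; apply: eq_bigr => j _.
  by rewrite mulr_suml; apply: eq_bigr => i _ /=; ring.
have iZ i j : P.-integrable setT
    (fun w => ((t i 0 * t j 0)%:E * (component X i w * component X j w)%:E)%E).
  exact: (integrableZl measurableT _ (iX i j)).
have sumE w : (\sum_(j < d) \sum_(i < d)
      (t i 0 * t j 0) * (component X i w * component X j w))%:E =
    (\sum_(j < d) \sum_(i < d)
      (t i 0 * t j 0)%:E * (component X i w * component X j w)%:E)%E.
  by rewrite -sumEFin; apply: eq_bigr => j _; rewrite -sumEFin.
rewrite unlock; under eq_integral => w _ do rewrite sumE.
rewrite integral_sum//; last by move=> j; exact: integrable_sum.
rewrite /quad_form mxE -sumEFin; apply: eq_bigr => j _.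
rewrite integral_sum// mxE mulr_suml -sumEFin; apply: eq_bigr => i _.
rewrite integralZl//; last exact: iX.
rewrite !mxE covariance_centered// unlock.
(* Matrix entries are taken through [fine], which loses nothing since the expectation is finite. *)
rewrite -[X in (_ * X)%E]fineK; last exact: (integrable_fin_num measurableT (iX i j)).
by rewrite -EFinM mulrAC.
Qed.

Lemma quad_form_ge0 t : centered X -> finite_second_moment X ->
  0 <= quad_form X t.
Proof.
move=> X0 X2; rewrite -lee_fin -expectation_dot_sqr//.
by apply: expectation_ge0 => w; exact: sqr_ge0.
Qed.

Lemma cumulant_eq0 t : centered X -> finite_second_moment X ->
  quad_form X t = 0 -> (cumulant X t = 0)%E.
Proof.
move=> X0 X2 V0.
have mS : measurable_fun setT (EFin \o (fun w => dot X t w ^+ 2)).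
  by apply/measurable_EFinP; apply: measurable_funX; exact: measurable_dot.
(* A nonnegative function with zero integral vanishes almost everywhere. *)
have dot0 : ae_eq P setT (EFin \o (fun w => dot X t w ^+ 2)) (cst 0%E).
  apply/ae_eq_integral_abs => //.
  have := expectation_dot_sqr t X0 X2; rewrite V0 unlock => dot2; rewrite -[RHS]dot2.
  by apply: eq_integral => w _ /=; rewrite ger0_norm// sqr_ge0.
rewrite /cumulant unlock.
rewrite (@ae_eq_integral _ _ _ P setT (cst 1%E))//; first last.
- apply: filterS dot0 => w /= /(_ I) [/eqP].
  by rewrite sqrf_eq0 => /eqP -> _; rewrite expR0.
- apply/measurable_EFinP; apply: measurableT_comp => //; exact: measurable_dot.
by rewrite integral_cst// mul1e /= probability_setT lne1.
Qed.

Lemma quad_formZ a t : quad_form X (a *: t) = a ^+ 2 * quad_form X t.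
Proof.
by rewrite /quad_form [(_ *: t)^T]linearZ/= -scalemxAr -!scalemxAl !mxE mulrA expr2.
Qed.

Definition radial_bound t c := 0 <= c /\
  forall s : R, 0 <= s -> (s%:E < (c%:E)^-1)%E ->
    (cumulant X (s *: t) <=
       (quad_form X t * s ^+ 2 / (2 * (1 - c * s)))%:E)%E.

(** Removes the extended inverse from the range of [s]. At [c = 0] both sides are true, because the
    inverse is [+oo]. *)
Lemma lt_inveE s c : 0 <= s -> 0 <= c -> (s%:E < (c%:E)^-1)%E = (c * s < 1).
Proof.
move=> s0 c0; rewrite inver; case: eqP => [->|/eqP c_neq0].
  by rewrite ltry mul0r ltr01.
by rewrite lte_fin -[_^-1]mul1r ltr_pdivlMr ?lt_def ?c_neq0// mulrC.
Qed.

Lemma radial_poleE t : 0 < quad_form X t ->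
  radial_pole X t = ereal_inf [set c%:E | c in radial_bound t].
Proof. by rewrite /radial_pole => ->. Qed.

Lemma radial_pole0 t : quad_form X t <= 0 -> radial_pole X t = 0%E.
Proof. by rewrite /radial_pole ltNge => ->. Qed.

Lemma radial_pole_ge0 t : (0 <= radial_pole X t)%E.
Proof.
rewrite /radial_pole; case: ifP => // _.
by apply: le_ereal_inf_tmp => _ [c [c0 _] <-]; rewrite lee_fin.
Qed.

(** The parameter [s] along [a *: t] is the parameter [s * a] along [t]; the products [c * (s * a)]
    and [(a * c) * s] agree, and the factor [a ^+ 2] of the quadratic form is absorbed into the
    square. *)
Lemma radial_boundZ a t c : 0 < a ->
  radial_bound t c -> radial_bound (a *: t) (a * c).
Proof.
move=> a0 [c0 tc]; have ac0 : 0 <= a * c by rewrite mulr_ge0// ltW.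
split=> // s s0; rewrite lt_inveE// scalerA => acs.
have as0 : 0 <= s * a by rewrite mulr_ge0// ltW.
have := tc _ as0; rewrite lt_inveE// quad_formZ.
have -> : c * (s * a) = a * c * s by ring.
have -> : a ^+ 2 * quad_form X t * s ^+ 2 = quad_form X t * (s * a) ^+ 2 by ring.
exact.
Qed.

(** Half of homogeneity, obtained by rescaling each competitor in the infimum; the other half is
    this one applied to [a^-1] and [a *: t]. *)
Lemma radial_pole_leZ a t : 0 < a ->
  (radial_pole X (a *: t) <= a%:E * radial_pole X t)%E.
Proof.
move=> a0; have a2 := exprn_gt0 2 a0.
have [V0|V0] := leP (quad_form X t) 0.
  by rewrite !radial_pole0 ?mule0// quad_formZ pmulr_rle0.
rewrite !radial_poleE ?quad_formZ ?mulr_gt0// -lee_pdivrMl//.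
apply: le_ereal_inf_tmp => _ [c tc <-].
rewrite lee_pdivrMl// -EFinM; apply: ereal_inf_lbound.
by exists (a * c) => //; exact: radial_boundZ.
Qed.

Lemma radial_poleZ a t : 0 <= a ->
  radial_pole X (a *: t) = (a%:E * radial_pole X t)%E.
Proof.
rewrite le_eqVlt => /predU1P[<-|a0].
  (* At [a = 0] the left side is a pole with zero quadratic form, and the right side is 0 even when
     the pole of [t] is [+oo]. *)
  by rewrite mul0e radial_pole0// quad_formZ expr0n mul0r.
apply/eqP; rewrite eq_le radial_pole_leZ//=.
rewrite -lee_pdivlMl// -{1}(scalerK (lt0r_neq0 a0) t).
by rewrite radial_pole_leZ// invr_gt0.
Qed.

Lemma cumulant_le_radial_pole t : 0 < quad_form X t ->
  (radial_pole X t < 1)%E ->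
  (cumulant X t <= (quad_form X t)%:E / (2%:E * (1 - radial_pole X t)))%E.
Proof.
move=> V0 C1; have C0 := radial_pole_ge0 t.
have Cfin : radial_pole X t \is a fin_num.
  by rewrite ge0_fin_numE// (lt_trans C1)// ltry.
(* An infimum below 1 provides a competitor [c < 1], whose finite bound later excludes
   [cumulant X t = +oo]. *)
have [_ [c [c0 tc] <-] c1] :
    exists2 x, [set c%:E | c in radial_bound t] x & (x < 1)%E.
  by apply/ereal_inf_lt; rewrite -radial_poleE.
(* The value [s = 1] is allowed precisely because [c' < 1]. *)
have bound c' : radial_bound t c' -> c' < 1 ->
    (cumulant X t <= (quad_form X t / (2 * (1 - c')))%:E)%E.
  move=> [c'0 tc'] c'1; have := tc' 1 ler01.
  by rewrite lt_inveE ?ler01// mulr1 scale1r expr1n mulr1; exact.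
have {C0 C1} := (C0, C1); rewrite -(fineK Cfin) lee_fin lte_fin => -[C0 C1].
set C := fine _ in C0 C1 *.
have D0 : 0 < 2 * (1 - C) by rewrite mulr_gt0 ?subr_gt0.
rewrite -EFinB -EFinM inver gt_eqF// -EFinM.
move Kk : (cumulant X t) => K; case: K Kk => [k||] Kk.
- rewrite lee_fin; have [k0|k0] := leP k 0.
    by rewrite (le_trans k0)// divr_ge0// ltW.
  rewrite ler_pdivlMr//.
  (* For [k > 0], the bound at [c' < 1] reads [1 - V / (2 k) <= c'], which
     passes to the infimum. *)
  suff : 1 - quad_form X t / (2 * k) <= C.
    rewrite lerBlDr -lerBlDl ler_pdivlMr ?mulr_gt0//; lra.
  rewrite -lee_fin fineK// radial_poleE//.
  apply: le_ereal_inf_tmp => _ [c' tc' <-]; rewrite lee_fin.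
  have [c'1|c'1] := ltP c' 1.
    have := bound _ tc' c'1; rewrite Kk lee_fin ler_pdivlMr ?mulr_gt0 ?subr_gt0//.
    rewrite lerBlDr -lerBlDl ler_pdivlMr ?mulr_gt0//; lra.
  (* For [c' >= 1] the value [s = 1] is out of range, but the left side is at most 1 anyway. *)
  by rewrite (le_trans _ c'1)// lerBlDr lerDl divr_ge0// ?mulr_ge0// ltW.
- by have := bound c (conj c0 tc); rewrite -lte_fin Kk => /(_ c1).
- by rewrite leNye.
Qed.

Lemma radial_pole_le q t : admissible_radial_denominator X q ->
  (radial_pole X t <= q t)%E.
Proof.
move=> [q0 qZ qK]; have [V0|V0] := leP (quad_form X t) 0.
  by rewrite radial_pole0.
move qt : (q t) (q0 t) => [c||]// c0; last by rewrite leey.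
rewrite lee_fin in c0.
rewrite radial_poleE//; apply: ereal_inf_lbound; exists c => //.
split=> // s s0; rewrite lt_inveE// => cs1.
have qst : q (s *: t) = (c * s)%:E by rewrite qZ// qt -EFinM mulrC.
have := qK (s *: t); rewrite qst lte_fin => /(_ cs1).
have D0 : 0 < 2 * (1 - c * s) by rewrite mulr_gt0 ?subr_gt0.
by rewrite -EFinB -EFinM inver gt_eqF// -EFinM quad_formZ [_ ^+ 2 * _]mulrC.
Qed.

End radial_pole_theory.

Theorem theorem2p8 (R : realType) (disp : measure_display)
    (T : measurableType disp) (P : probability T R) (d : nat)
    (X : {RV P >-> d.-tuple R}) :
  centered X -> finite_second_moment X -> infinitely_divisible X ->
  admissible_radial_denominator X (radial_pole X) /\
  (forall q : 'cV[R]_d -> \bar R, admissible_radial_denominator X q ->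
     forall t : 'cV[R]_d, (radial_pole X t <= q t)%E).
Proof.
move=> X0 X2 _; split; last by move=> q qX t; exact: radial_pole_le.
split; [exact: radial_pole_ge0 | by move=> a t; exact: radial_poleZ |].
move=> t C1; have := quad_form_ge0 X t X0 X2.
(* In the degenerate case both sides of the bound are 0. *)
rewrite le_eqVlt => /predU1P[V0|V0]; last exact: cumulant_le_radial_pole.
by rewrite cumulant_eq0// -V0 mul0e.
Qed.
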